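(* For every choice of real parameters $0\le\sigma_i,\eta_i\le4$ ($1\le i\le4$), the coefficient sequence of $\prod_{i=1}^4Q_{\sigma_i,\eta_i}(z)$ is strictly log-concave.
   Context: For $0\le\sigma,\eta\le4$, $$Q_{\sigma,\eta}(z)=1+(4+\sigma)z+(2+4\sigma+\eta)z^2+(4+\sigma)z^3+z^4.$$ The coefficient sequence $(C_0,\dots,C_{16})$ of a degree-$16$ polynomial $\sum_{k=0}^{16}C_kz^k$ with nonnegative coefficients is strictly log-concave if $C_k^2-C_{k-1}C_{k+1}>0$ for all $1\le k\le15$. *)

(* Defs.v *)
From mathcomp Require Import all_boot all_order all_algebra.
From mathcomp Require Import reals.

Set Implicit Arguments.
Unset Strict Implicit.
Unset Printing Implicit Defensive.

Import Order.TTheory GRing.Theory Num.Theory.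

Local Open Scope ring_scope.

Definition Q (R : realType) (sigma eta : R) : {poly R} :=
  1 + (4 + sigma) *: 'X + (2 + 4 * sigma + eta) *: 'X^2
    + (4 + sigma) *: 'X^3 + 'X^4.

(* Degree [n] and nonnegativity of the coefficients are standing requirements
   on the polynomials to which the notion applies, so they are part of it.
   The bound [0 < k] makes the truncated predecessor [k.-1] genuine. *)
Definition strictly_log_concave (R : realType) (n : nat) (p : {poly R}) : Prop :=
  [/\ size p = n.+1,
      forall k : nat, 0 <= p`_k
    & forall k : nat, (0 < k < n)%N -> 0 < p`_k ^+ 2 - p`_k.-1 * p`_k.+1].

(* Main.v *)
Require Import Defs.
From Stdlib Require Import NArith.
From mathcomp Require Import all_boot all_order all_algebra.
From mathcomp Require Import ring lra zify reals.

Import Order.TTheory GRing.Theory Num.Theory.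

Local Open Scope ring_scope.

(** The quartic [Q s e] depends affinely on [(s, e)], so over the triangle
    [0 <= s], [0 <= e], [s + e <= 8], which contains the square of the
    theorem, it is a convex combination of its values at the three vertices
    [(0, 0)], [(8, 0)], [(0, 8)]. Log-concavity is a quadratic condition on
    the product, and becomes linear on its tensor square: with
    [p (x) p = p(x) p(y)], the quantity [p_k ^ 2 - p_(k-1) p_(k+1)] is the
    value at [p (x) p] of the linear functional [log_gap k].

    The tensor square is multiplicative, so the tensor square of the product
    of the four quartics is the product of the [Q_i (x) Q_i]. Each of these is
    a combination with nonnegative weights of the symmetrised tensors
    [q_v (x) q_w + q_w (x) q_v] of the vertex quartics ([tensor_Q]). Expanding
    the product leaves a combination, with nonnegative weights of positive
    total, of fourfold products of symmetrised tensors. There are six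
    symmetrised tensors, hence finitely many such products, all with integer
    coefficients, and a direct evaluation shows that every [log_gap k] with
    [0 < k < 16] is positive on each of them ([positive_gaps_fourfold]).

    Symmetrising each factor separately is what makes the finite check
    succeed. Expanding the product of the [Q_i] itself would require the
    polarised gap of any two products of vertex quartics to be positive, which
    fails at [k = 4] for the fourth powers of the quartics at [(0, 0)] and
    [(8, 0)]. *)

(** * Polynomials as coefficient lists *)

(** Lists of coefficients make products of polynomials computable. The
    coefficient type is abstract because the bivariate polynomials below are
    lists of lists: the construction is applied to its own result. *)
Section ListArithmetic.

Variables (A : Type) (zero : A) (add mul : A -> A -> A).

Fixpoint list_add (s t : seq A) : seq A :=
  match s, t with
  | [::], _ => t
  | _, [::] => s
  | a :: s', b :: t' => add a b :: list_add s' t'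
  end.

Fixpoint list_mul (s t : seq A) : seq A :=
  if s is a :: s' then list_add (map (mul a) t) (zero :: list_mul s' t)
  else [::].

Variables (S : comNzRingType) (phi : A -> S).
Hypotheses (phi0 : phi zero = 0) (phiD : {morph phi : a b / add a b >-> a + b}).
Hypothesis phiM : {morph phi : a b / mul a b >-> a * b}.

Definition list_poly (s : seq A) : {poly S} := Poly (map phi s).

Lemma list_poly_cons a s :
  list_poly (a :: s) = list_poly s * 'X + (phi a)%:P.
Proof. by rewrite /list_poly /= cons_poly_def. Qed.

Lemma list_polyD : {morph list_poly : s t / list_add s t >-> s + t}.
Proof.
elim=> [|a s IH] [|b t]; rewrite ?(add0r, addr0) //.
by rewrite !list_poly_cons IH phiD polyCD; ring.
Qed.

Lemma list_poly_scale a s :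
  list_poly (map (mul a) s) = (phi a)%:P * list_poly s.
Proof.
elim: s => [|b s IH]; first by rewrite mulr0.
by rewrite [map _ _]/= !list_poly_cons IH phiM polyCM; ring.
Qed.

Lemma list_polyM : {morph list_poly : s t / list_mul s t >-> s * t}.
Proof.
elim=> [|a s IH] t; first by rewrite mul0r.
rewrite [list_mul _ _]/= list_polyD list_poly_scale !list_poly_cons IH phi0.
by rewrite addr0; ring.
Qed.

Lemma coef_list_poly s i : (list_poly s)`_i = phi (nth zero s i).
Proof.
rewrite coef_Poly; have [lt_is|le_si] := ltnP i (size s).
  exact: nth_map.
by rewrite !nth_default ?size_map ?phi0.
Qed.

End ListArithmetic.

Arguments list_add {A} add s t.
Arguments list_mul {A} zero add mul s t.
Arguments list_poly {A S} phi s.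

(** * Squares of polynomials as bivariate polynomials *)

Section Tensor.

Variable R : comNzRingType.

(** [p(x) q(y)], where [x] is the variable of the outer polynomial ring. *)
Definition tensor (p q : {poly R}) : {poly {poly R}} := p^:P * q%:P.

Lemma coef_tensor p q i j : (tensor p q)`_i`_j = p`_i * q`_j.
Proof. by rewrite /tensor coefMC coef_map coefCM. Qed.

Lemma tensor_prod (I : finType) (p q : I -> {poly R}) :
  tensor (\prod_i p i) (\prod_i q i) = \prod_i tensor (p i) (q i).
Proof. by rewrite /tensor !rmorph_prod big_split. Qed.

Lemma tensor_sum_sum (I J : finType) (p : I -> {poly R}) (q : J -> {poly R}) :
  tensor (\sum_i p i) (\sum_j q j) = \sum_i \sum_j tensor (p i) (q j).
Proof.
rewrite /tensor !rmorph_sum mulr_suml; apply: eq_bigr => i _.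
by rewrite mulr_sumr.
Qed.

Lemma tensor_scale a b p q :
  tensor (a *: p) (b *: q) = (a * b)%:P%:P * tensor p q.
Proof.
rewrite /tensor map_polyZ -!mul_polyC !polyCM; ring.
Qed.

Definition log_gap (k : nat) (T : {poly {poly R}}) : R :=
  T`_k`_k - T`_k.-1`_k.+1.

Lemma log_gap_tensor k p :
  log_gap k (tensor p p) = p`_k ^+ 2 - p`_k.-1 * p`_k.+1.
Proof. by rewrite /log_gap !coef_tensor expr2. Qed.

Lemma log_gap_sum k (I : finType) (T : I -> {poly {poly R}}) :
  log_gap k (\sum_i T i) = \sum_i log_gap k (T i).
Proof. by rewrite /log_gap !coef_sum -sumrB. Qed.

Lemma log_gap_scale k a T : log_gap k (a%:P%:P * T) = a * log_gap k T.
Proof. by rewrite /log_gap !coefCM mulrBr. Qed.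

End Tensor.

Arguments tensor {R} p q.
Arguments log_gap {R} k T.

(** * The symmetrised products of the three vertex quartics *)

(** The coefficients of [Q 0 0], [Q 8 0] and [Q 0 8]. *)
Definition vertex (v : nat) : seq N :=
  nth [::] [:: [:: 1; 4; 2; 4; 1]; [:: 1; 12; 34; 12; 1];
               [:: 1; 4; 10; 4; 1]]%num v.

Definition outer (s t : seq N) : seq (seq N) :=
  [seq [seq N.mul a b | b <- t] | a <- s].

Definition add2 : seq (seq N) -> seq (seq N) -> seq (seq N) :=
  list_add (list_add N.add).

Definition mul2 : seq (seq N) -> seq (seq N) -> seq (seq N) :=
  list_mul [::] (list_add N.add) (list_mul N0 N.add N.mul).

Definition sym_outer (v w : nat) : seq (seq N) :=
  add2 (outer (vertex v) (vertex w)) (outer (vertex w) (vertex v)).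

(** Removing duplicates exploits [sym_outer v w = sym_outer w v] and the
    commutativity of products: 81 products collapse to 21. *)
Definition twofold_products : seq (seq (seq N)) :=
  let gens := undup [seq sym_outer v w | v <- iota 0 3, w <- iota 0 3] in
  undup [seq mul2 S1 S2 | S1 <- gens, S2 <- gens].

Definition coef2 (T : seq (seq N)) (i j : nat) : N :=
  nth N0 (nth [::] T i) j.

Definition positive_gaps (T : seq (seq N)) : bool :=
  all (fun k => N.ltb (coef2 T k.-1 k.+1) (coef2 T k k)) (iota 1 15).

(** Every fourfold product is a product of two twofold ones, so pairs of the
    latter cover all of them. The 441 cases are evaluated in binary
    arithmetic. *)
Lemma positive_gaps_fourfold :
  allrel (fun T1 T2 => positive_gaps (mul2 T1 T2))
    twofold_products twofold_products.
Proof. by vm_cast_no_check (erefl true). Qed.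

Lemma positive_gaps_sym_outer (a b : 'I_4 -> 'I_3) :
  positive_gaps
    (mul2 (mul2 (sym_outer (a 0) (b 0)) (sym_outer (a 1) (b 1)))
       (mul2 (sym_outer (a 2%:R) (b 2%:R)) (sym_outer (a 3%:R) (b 3%:R)))).
Proof.
have in_twofold i j : mul2 (sym_outer (a i) (b i)) (sym_outer (a j) (b j))
    \in twofold_products.
  have in_iota (v : 'I_3) : (v : nat) \in iota 0 3 by rewrite mem_iota ltn_ord.
  by rewrite mem_undup allpairs_f // mem_undup allpairs_f.
exact: (allrelP positive_gaps_fourfold).
Qed.

Section Denotation.

Variable R : realDomainType.

Definition N_to_ring (n : N) : R := (N.to_nat n)%:R.

Let N_to_ringD : {morph N_to_ring : a b / N.add a b >-> a + b}.
Proof. by move=> a b; rewrite /N_to_ring N2Nat.inj_add plusE natrD. Qed.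

Let N_to_ringM : {morph N_to_ring : a b / N.mul a b >-> a * b}.
Proof. by move=> a b; rewrite /N_to_ring N2Nat.inj_mul multE natrM. Qed.

Definition bipoly (T : seq (seq N)) : {poly {poly R}} :=
  list_poly (list_poly N_to_ring) T.

Lemma bipolyD : {morph bipoly : S T / add2 S T >-> S + T}.
Proof. exact/list_polyD/list_polyD. Qed.

Lemma bipolyM : {morph bipoly : S T / mul2 S T >-> S * T}.
Proof.
apply list_polyM => //; first exact: list_polyD.
exact: list_polyM.
Qed.

Lemma bipoly_outer s t :
  bipoly (outer s t) = tensor (list_poly N_to_ring s) (list_poly N_to_ring t).
Proof.
elim: s => [|a s IH]; first by rewrite /tensor rmorph0 mul0r.
rewrite [outer _ _]/= /bipoly list_poly_cons -/(bipoly _) IH.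
rewrite (list_poly_scale _ N.mul _ _ N_to_ringM) list_poly_cons /tensor.
rewrite rmorphD rmorphM /= map_polyX map_polyC /= polyCM.
by ring.
Qed.

(** The gap is an integer, whence the bound [1]. It is uniform in [T], which
    lets positivity survive an average in which some weights vanish. *)
Lemma log_gap_bipoly k T :
  (0 < k < 16)%N -> positive_gaps T -> 1 <= log_gap k (bipoly T).
Proof.
move=> k_range /allP/(_ k).
rewrite mem_iota => /(_ k_range) /N.ltb_spec0 lt_gap.
have coefE i j : (bipoly T)`_i`_j = N_to_ring (coef2 T i j).
  by rewrite (coef_list_poly _ [::]) // (coef_list_poly _ N0).
rewrite /log_gap !coefE /N_to_ring lerBrDr nat1r ler_nat.
lia.
Qed.

End Denotation.

Arguments bipoly {R} T.
Arguments N_to_ring {R} n.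

(** * The quartic factors *)

Section Quartic.

Variable R : realType.
Implicit Types s e : R.

Lemma Q_Poly s e :
  Q s e = Poly [:: 1; 4 + s; 2 + 4 * s + e; 4 + s; 1].
Proof.
rewrite /Q; apply/polyP => i; rewrite !coefE.
by do 5?[case: i => [|i] /=]; rewrite ?nth_nil; ring.
Qed.

Lemma size_Q s e : size (Q s e) = 5.
Proof. by rewrite Q_Poly (PolyK (c := 0)) //= oner_neq0. Qed.

Lemma Q_polyOver_nneg s e : 0 <= s -> 0 <= e -> Q s e \is a polyOver Num.nneg.
Proof.
move=> s_ge0 e_ge0; rewrite Q_Poly; apply/polyOverP => i; rewrite coef_Poly.
rewrite nnegrE; do 5?[case: i => [|i] /=]; rewrite ?nth_nil //; lra.
Qed.

(** Barycentric coordinates of [(s, e)] in the triangle with vertices [(0, 0)],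
    [(8, 0)], [(0, 8)]. *)
Definition weight s e (v : 'I_3) : R :=
  nth 0 [:: 1 - (s + e) / 8; s / 8; e / 8] v.

Lemma weight_ge0 s e v : 0 <= s -> 0 <= e -> s + e <= 8 -> 0 <= weight s e v.
Proof.
move=> s_ge0 e_ge0 se_le8.
by case: v => [[|[|[|]]] ltv3] //; rewrite /weight /=; lra.
Qed.

Lemma sum_weight s e : \sum_v weight s e v = 1.
Proof. by rewrite !big_ord_recl big_ord0 /weight /=; field. Qed.

Lemma Q_barycentric s e :
  Q s e = \sum_v weight s e v *: list_poly N_to_ring (vertex v).
Proof.
rewrite Q_Poly !big_ord_recl big_ord0 /weight /=; apply/polyP => i.
rewrite !coefE /N_to_ring /= /PosDef.Pos.to_nat.
by do 5?[case: i => [|i] /=]; rewrite ?nth_nil ?if_same; field.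
Qed.

(** The factor [1 / 2] compensates for the symmetrisation, which counts each
    ordered pair of vertices twice. *)
Definition pair_weight s e (vw : 'I_3 * 'I_3) : R :=
  weight s e vw.1 * weight s e vw.2 / 2.

Lemma sum_pair_weight s e : \sum_vw pair_weight s e vw = 1 / 2.
Proof.
rewrite -mulr_suml; congr (_ / 2).
rewrite -(pair_bigA _ (fun v w => weight s e v * weight s e w)) /=.
by rewrite -big_distrlr /= !sum_weight mulr1.
Qed.

(** Bilinearity expands the tensor square over ordered pairs of vertices;
    symmetrising is possible because the weight of a pair is symmetric. *)
Lemma tensor_Q s e :
  tensor (Q s e) (Q s e) =
  \sum_vw (pair_weight s e vw)%:P%:P * bipoly (sym_outer vw.1 vw.2).
Proof.
pose p (v : 'I_3) : {poly R} := list_poly N_to_ring (vertex v).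
pose half (v w : 'I_3) :=
  (weight s e v * weight s e w / 2)%:P%:P * tensor (p v) (p w).
have -> : tensor (Q s e) (Q s e) = \sum_v \sum_w (half v w + half v w).
  rewrite Q_barycentric tensor_sum_sum; apply: eq_bigr => v _.
  apply: eq_bigr => w _; rewrite tensor_scale /half -mulrDl -!polyCD.
  by congr (_%:P%:P * _); field.
transitivity (\sum_v \sum_w (half v w + half w v)).
  under eq_bigr do rewrite big_split; rewrite big_split /=.
  under [RHS]eq_bigr do rewrite big_split; rewrite big_split /=.
  by congr (_ + _); rewrite exchange_big.
rewrite pair_bigA; apply: eq_bigr => -[v w] _ /=.
rewrite /half /sym_outer bipolyD !bipoly_outer mulrDr.
by rewrite [weight s e w * _]mulrC.
Qed.

End Quartic.

Arguments pair_weight {R} s e vw.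

Theorem theorem4p4 (R : realType) (sigma eta : 'I_4 -> R)
  (hsigma : forall i : 'I_4, 0 <= sigma i <= 4)
  (heta : forall i : 'I_4, 0 <= eta i <= 4) :
  strictly_log_concave 16 (\prod_(i < 4) Q (sigma i) (eta i)).
Proof.
have sigma_ge0 i : 0 <= sigma i by have /andP[] := hsigma i.
have eta_ge0 i : 0 <= eta i by have /andP[] := heta i.
split.
- have Q_neq0 i : Q (sigma i) (eta i) != 0 by rewrite -size_poly_gt0 size_Q.
  rewrite size_prod // (eq_bigr (fun=> 5%N)) => [|i _]; last exact: size_Q.
  by rewrite sum_nat_const card_ord.
- move=> k; rewrite -nnegrE; move: k; apply/polyOverP; apply: rpred_prod => i _.
  exact: Q_polyOver_nneg.
move=> k k_range; rewrite -log_gap_tensor tensor_prod.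
under eq_bigr do rewrite tensor_Q.
(* Expand the product of sums: [f] picks one symmetrised tensor per factor. *)
rewrite bigA_distr_bigA log_gap_sum /=.
pose c (f : {ffun 'I_4 -> 'I_3 * 'I_3}) :=
  \prod_i pair_weight (sigma i) (eta i) (f i).
have c_ge0 f : 0 <= c f.
  apply: prodr_ge0 => i _; rewrite /pair_weight divr_ge0 // mulr_ge0 //;
    apply: weight_ge0 => //; have := hsigma i; have := heta i; lra.
have sum_c : 0 < \sum_f c f.
  rewrite -(bigA_distr_bigA (fun i => pair_weight (sigma i) (eta i))).
  apply: prodr_gt0 => i _; rewrite sum_pair_weight; lra.
(* Each gap is at least 1, so the total is at least the sum of the weights. *)
apply: (lt_le_trans sum_c); apply: ler_sum => f _.
rewrite big_split /= -!rmorph_prod log_gap_scale -/(c f) ler_peMr //.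
rewrite !big_ord_recl big_ord0 mulr1 mulrA -!bipolyM.
apply: log_gap_bipoly => //.
have := positive_gaps_sym_outer (fun i => (f i).1) (fun i => (f i).2).
congr (positive_gaps (mul2 (mul2 _ _) (mul2 _ _)));
  by congr (sym_outer (f _).1 (f _).2); apply: val_inj.
Qed.
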